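(* Let $f:\mathbb{R}^n\to\mathbb{R}$ be a smooth ($\mathcal{C}^1$) function whose gradient is Lipschitz continuous with some constant $L>0$. Let $\{x^k\}_{k\ge 1}\subset\mathbb{R}^n$ be generated from some initial point $x^1\in\mathbb{R}^n$ by $$x^{k+1}=x^k-t_kg^k,\qquad \|g^k-\nabla f(x^k)\|\le\varepsilon_k,\qquad k=1,2,\ldots,$$ with sequences of stepsizes $\{t_k\}\subset(0,\infty)$ and errors $\{\varepsilon_k\}\subset(0,\infty)$ satisfying $$\sum_{k=1}^\infty t_k=\infty,\qquad t_k\downarrow 0,\qquad \sum_{k=1}^\infty t_k\varepsilon_k<\infty,\qquad \limsup_{k\to\infty}\varepsilon_k<2.$$ Assume that $\inf_{k\in\mathbb{N}}f(x^k)>-\infty$. Then the following convergence properties hold: (i) $\nabla f(x^k)\to 0$, and thus every accumulation point of $\{x^k\}$ is stationary for $f$. (ii) If $\bar x$ is an accumulation point of the sequence $\{x^k\}$, then $f(x^k)\to f(\bar x)$. (iii) Suppose that $f$ satisfies the KL property at some accumulation point $\bar x$ of $\{x^k\}$ with a desingularizing function $\varphi$ for which there is some $C>0$ such that $$C[\varphi'(x+y)]^{-1}\le(\varphi'(x))^{-1}+(\varphi'(y))^{-1}\quad\text{whenever }x,y\in(0,\eta)\text{ with }x+y<\eta.$$ Assume in addition that $$\sum_{k=1}^\infty t_k\left(\varphi'\left(\sum_{i=k}^\infty t_i\varepsilon_i\right)\right)^{-1}<\infty,$$ and that $f(x^k)>f(\bar x)$ for all sufficiently large $k\in\mathbb{N}$.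 Then $x^k\to\bar x$ as $k\to\infty$. In particular, suppose (without assuming $f(x^k)>f(\bar x)$) that $f$ satisfies the KL property at some accumulation point $\bar x$ of $\{x^k\}$ with a desingularizing function $\varphi$ for which there is some $C>0$ such that $C[\varphi'(x+y)]^{-1}\le(\varphi'(x))^{-1}+(\varphi'(y))^{-1}$ whenever $x,y\in(0,\eta)$ with $x+y<\eta$, and that $\sum_{k=1}^\infty t_k\left(\varphi'\left(\sum_{i=k}^\infty t_i\varepsilon_i\right)\right)^{-1}<\infty$; if $\bar x$ is a global minimizer of $f$, then either $f(x^k)=f(\bar x)$ for some $k\in\mathbb{N}$, or $x^k\to\bar x$.
   Context: $\mathbb{N}=\{1,2,\ldots\}$, and $\|\cdot\|$ is the Euclidean norm on $\mathbb{R}^n$. A point $\bar x$ is stationary for $f$ if $\nabla f(\bar x)=0$. The notation $t_k\downarrow0$ means that the positive numbers $t_k$ converge to $0$ (monotonicity is not required). KL (Kurdyka-Łojasiewicz) property: a smooth function $f:\mathbb{R}^n\to\mathbb{R}$ satisfies the KL property at $\bar x\in\mathbb{R}^n$ if there exist $\eta\in(0,\infty]$, a neighborhood $U$ of $\bar x$, and a concave continuous function $\varphi:[0,\eta)\to[0,\infty)$ (called a desingularizing function) such that $\varphi(0)=0$, $\varphi$ is $\mathcal{C}^1$-smooth on $(0,\eta)$, $\varphi'>0$ on $(0,\eta)$, and for all $x\in U$ with $0<f(x)-f(\bar x)<\eta$ one has $\varphi'(f(x)-f(\bar x))\|\nabla f(x)\|\ge1$. The number $\eta$ in (iii) is the one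 associated with $\varphi$. In the summability condition of (iii), $\varphi'$ is defined only on $(0,\eta)$; the finitely many terms for which $\sum_{i=k}^\infty t_i\varepsilon_i\ge\eta$ (if any) are disregarded. *)

(* Defs.v *)
From HB Require Import structures.
From mathcomp Require Import all_boot all_order all_algebra.
From mathcomp Require Import all_classical all_reals all_analysis.

Set Implicit Arguments.
Unset Strict Implicit.
Unset Printing Implicit Defensive.

Import Order.TTheory GRing.Theory Num.Theory.
Import numFieldNormedType.Exports.

Local Open Scope ring_scope.
Local Open Scope classical_set_scope.

(* The canonical norm `|x| on 'rV[R]_n is the sup norm (inducing the same
   topology), so the Euclidean norm has to be introduced separately. *)
Definition enorm (R : realType) (n : nat) (x : 'rV[R]_n) : R :=
  Num.sqrt (\sum_(i < n) x ord0 i ^+ 2).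

Definition grad (R : realType) (n : nat) (f : 'rV[R]_n -> R) (x : 'rV[R]_n) :
    'rV[R]_n :=
  \row_(i < n) 'D_(delta_mx ord0 i) f x.

Definition C1 (R : realType) (n : nat) (f : 'rV[R]_n -> R) : Prop :=
  (forall x, differentiable f x) /\ continuous (grad f).

Definition stationary (R : realType) (n : nat) (f : 'rV[R]_n -> R)
    (x : 'rV[R]_n) : Prop := grad f x = 0.

Definition accumulation_point (R : realType) (n : nat) (x : nat -> 'rV[R]_n)
    (xbar : 'rV[R]_n) : Prop := cluster (x @ \oo) xbar.

(* A function phi : [0, eta) -> [0, oo), with eta in (0, +oo], is represented by
   a total function whose values outside [0, eta) play no role. *)
Definition desingularizing (R : realType) (eta : \bar R) (phi : R -> R) : Prop :=
  let D := [set s : R | 0 <= s /\ (s%:E < eta)%E] in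
  [/\ forall s, D s -> 0 <= phi s,
      convex_function (D : set R^o) (fun s : R^o => - phi s),
      {within D, continuous phi},
      phi 0 = 0 &
      forall s : R, 0 < s -> (s%:E < eta)%E ->
        [/\ derivable phi s 1, {for s, continuous (derive1 phi)} & 0 < derive1 phi s]].

Definition KL_with (R : realType) (n : nat) (f : 'rV[R]_n -> R)
    (xbar : 'rV[R]_n) (eta : \bar R) (phi : R -> R) : Prop :=
  [/\ (0 < eta)%E, desingularizing eta phi &
      exists2 U : set 'rV[R]_n, nbhs xbar U &
        forall x, U x -> 0 < f x - f xbar -> ((f x - f xbar)%:E < eta)%E ->
          1 <= derive1 phi (f x - f xbar) * enorm (grad f x)].

Definition quasi_additive (R : realType) (eta : \bar R) (phi : R -> R) : Prop :=
  exists2 C : R, 0 < C &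
    forall x y : R, 0 < x -> (x%:E < eta)%E -> 0 < y -> (y%:E < eta)%E ->
      ((x + y)%:E < eta)%E ->
      C * (derive1 phi (x + y))^-1 <= (derive1 phi x)^-1 + (derive1 phi y)^-1.

Definition error_tail (R : realType) (t eps : nat -> R) (k : nat) : \bar R :=
  (\sum_(k <= i <oo) (t i * eps i)%:E)%E.

(* Since phi' lives on (0, eta) only, the series skips the indices k whose error
   tail is at least eta; for the other ones the tail is a real number. *)
Definition summable_errors (R : realType) (eta : \bar R) (phi : R -> R)
    (t eps : nat -> R) : Prop :=
  (\sum_(1 <= k <oo | error_tail t eps k < eta)
     (t k * (derive1 phi (fine (error_tail t eps k)))^-1)%:E < +oo)%E.

(* Main.v *)
Require Import Defs.
From HB Require Import structures.
From mathcomp Require Import all_boot all_order all_algebra.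
From mathcomp Require Import all_classical all_reals all_analysis.
From mathcomp Require Import ring lra.

Set Implicit Arguments.
Unset Strict Implicit.
Unset Printing Implicit Defensive.

Import Order.TTheory GRing.Theory Num.Theory.
Import numFieldNormedType.Exports.

Local Open Scope ring_scope.
Local Open Scope classical_set_scope.

(** Write a_k for the norm of the gradient at x_k and tau_k for the error tail
    sum_(i >= k) t_i * eps_i. For large k, the descent lemma and the bound 2 on
    the errors give
      f(x_(k+1)) <= f(x_k) - c * t_k * a_k^2 + t_k * eps_k
    with some c > 0 ([inexact_step_decrease]). The coefficient of the error
    term is 1, so that the merit f(x_k) + tau_k decreases by at least
    c * t_k * a_k^2. Being bounded below, it converges, and the series of
    t_k * a_k^2 converges as well.

    Gradients. As the steps t_k have an infinite sum, a_k is small infinitely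
    often. Since the gradient is Lipschitz, a_k changes by at most
    L * t_k * (a_k + eps_k) in a step, and above a threshold delta the part
    t_k * a_k is dominated by t_k * a_k^2 / delta, which is summable. Hence a_k
    cannot climb back from delta to 3 * delta ([dissipation_vanishes]), and the
    gradients tend to 0.

    Values. The merit is monotone and tau_k tends to 0, so the values converge
    to f at any accumulation point ([decreasing_to_cluster_value]).

    Iterates under the KL inequality. Put u_k = f(x_k) - f(xbar) > 0 and
    Delta_k = u_k + tau_k. By concavity, phi(Delta_k) - phi(Delta_(k+1)) is at
    least phi'(Delta_k) * c * t_k * a_k^2, and by quasi-additivity
    C / phi'(Delta_k) <= 1 / phi'(u_k) + 1 / phi'(tau_k), where the KL inequality
    bounds the first term by a_k. Together,
      C * c * t_k * a_k^2
        <= (phi(Delta_k) - phi(Delta_(k+1))) * (a_k + 1 / phi'(tau_k)).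
    Dividing out one factor a_k ([quadratic_cancel]) leaves
      t_k * a_k <= (phi(Delta_k) - phi(Delta_(k+1))) / (C * c)
                   + t_k / phi'(tau_k),
    a telescoping term plus a summable one. The step lengths are therefore
    summable as long as the iterates stay in the neighborhood where the KL
    inequality holds, and from a late index with x_k close to xbar on, they
    never leave a given ball ([trapped_sequence_cvg], [KL_descent_cvg]). At a
    global minimizer, f(x_k) >= f(xbar) always, so either some value is equal to
    the minimum or this argument applies. *)

(** * The Euclidean norm *)

Definition edot (R : realType) (n : nat) (u v : 'rV[R]_n) : R :=
  \sum_(i < n) u ord0 i * v ord0 i.

Lemma edotC (R : realType) (n : nat) (u v : 'rV[R]_n) : edot u v = edot v u.
Proof. by apply: eq_bigr => i _; rewrite mulrC. Qed.

Lemma edotDl (R : realType) (n : nat) (u v w : 'rV[R]_n) :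
  edot (u + v) w = edot u w + edot v w.
Proof. by rewrite -big_split; apply: eq_bigr => i _ /=; rewrite mxE mulrDl. Qed.

Lemma edotZl (R : realType) (n : nat) (a : R) (u v : 'rV[R]_n) :
  edot (a *: u) v = a * edot u v.
Proof. by rewrite mulr_sumr; apply: eq_bigr => i _ /=; rewrite mxE mulrA. Qed.

Lemma edotDr (R : realType) (n : nat) (u v w : 'rV[R]_n) :
  edot w (u + v) = edot w u + edot w v.
Proof. by rewrite edotC edotDl !(edotC w). Qed.

Lemma edotZr (R : realType) (n : nat) (a : R) (u v : 'rV[R]_n) :
  edot u (a *: v) = a * edot u v.
Proof. by rewrite edotC edotZl edotC. Qed.

Lemma enorm_ge0 (R : realType) (n : nat) (u : 'rV[R]_n) : 0 <= enorm u.
Proof. exact: sqrtr_ge0. Qed.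

Lemma edot_self (R : realType) (n : nat) (u : 'rV[R]_n) :
  edot u u = enorm u ^+ 2.
Proof.
rewrite /enorm sqr_sqrtr; last by apply: sumr_ge0 => i _; rewrite sqr_ge0.
by apply: eq_bigr => i _; rewrite expr2.
Qed.

Lemma enormZ (R : realType) (n : nat) (a : R) (u : 'rV[R]_n) :
  enorm (a *: u) = `|a| * enorm u.
Proof.
apply/eqP; rewrite -(@eqrXn2 _ 2) ?mulr_ge0 ?enorm_ge0//.
by rewrite -edot_self edotZl edotZr edot_self exprMn real_normK ?num_real// mulrA.
Qed.

Lemma enormN (R : realType) (n : nat) (u : 'rV[R]_n) : enorm (- u) = enorm u.
Proof. by rewrite -scaleN1r enormZ normrN1 mul1r. Qed.

Lemma enormB (R : realType) (n : nat) (u v : 'rV[R]_n) :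
  enorm (u - v) = enorm (v - u).
Proof. by rewrite -enormN opprB. Qed.

Lemma coord_le_enorm (R : realType) (n : nat) (u : 'rV[R]_n) (i : 'I_n) :
  `|u ord0 i| <= enorm u.
Proof.
rewrite -sqrtr_sqr ler_wsqrtr// (bigD1 i)//= lerDl.
by apply: sumr_ge0 => j _; rewrite sqr_ge0.
Qed.

Lemma cauchy_schwarz (R : realType) (n : nat) (u v : 'rV[R]_n) :
  edot u v <= enorm u * enorm v.
Proof.
have [u0|u_neq0] := eqVneq (enorm u) 0.
  rewrite u0 mul0r /edot big1// => i _.
  have := coord_le_enorm u i; rewrite u0 normr_le0 => /eqP ->.
  by rewrite mul0r.
have [v0|v_neq0] := eqVneq (enorm v) 0.
  rewrite v0 mulr0 /edot big1// => i _.
  have := coord_le_enorm v i; rewrite v0 normr_le0 => /eqP ->.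
  by rewrite mulr0.
have uv_gt0 : 0 < enorm u * enorm v.
  by rewrite mulr_gt0// lt_neqAle eq_sym enorm_ge0 ?u_neq0 ?v_neq0.
(* expand the square of the difference of the two vectors scaled to equal norm *)
have := sqr_ge0 (enorm (enorm v *: u + (- enorm u) *: v)).
rewrite -edot_self edotDl !edotDr !edotZl !edotZr (edotC v u) !edot_self => sq.
rewrite -(ler_pM2l uv_gt0); nra.
Qed.

Lemma enormD (R : realType) (n : nat) (u v : 'rV[R]_n) :
  enorm (u + v) <= enorm u + enorm v.
Proof.
rewrite -ler_sqr ?nnegrE ?addr_ge0 ?enorm_ge0//.
rewrite -edot_self edotDl !edotDr (edotC v u) !edot_self.
by have := cauchy_schwarz u v; nra.
Qed.

Lemma enorm_triangle (R : realType) (n : nat) (u v w : 'rV[R]_n) :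
  enorm (u - w) <= enorm (u - v) + enorm (v - w).
Proof. by have := enormD (u - v) (v - w); rewrite subrKA. Qed.

Lemma enormD_sqr_le (R : realType) (n : nat) (u v : 'rV[R]_n) :
  enorm (u + v) ^+ 2 <= 2 * enorm u ^+ 2 + 2 * enorm v ^+ 2.
Proof.
have := sqr_ge0 (enorm u - enorm v).
have := enormD u v; have := enorm_ge0 (u + v).
by have := enorm_ge0 u; have := enorm_ge0 v; nra.
Qed.

Lemma norm_le_enorm (R : realType) (n : nat) (u : 'rV[R]_n) :
  `|u| <= enorm u.
Proof.
rewrite [`|u|]mx_normrE; apply/bigmax_leP; split; first exact: enorm_ge0.
by move=> [i j] _ /=; rewrite ord1; exact: coord_le_enorm.
Qed.

Lemma enorm_le_norm (R : realType) (n : nat) (u : 'rV[R]_n) :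
  enorm u <= Num.sqrt n%:R * `|u|.
Proof.
rewrite -[X in _ * X]ger0_norm// -sqrtr_sqr -sqrtrM// ler_wsqrtr//.
rewrite -[n in n%:R]card_ord -sumr_const mulr_suml ler_sum// => i _.
rewrite mul1r -[leLHS]real_normK ?num_real//.
rewrite ler_sqr ?nnegrE// [leRHS]mx_normrE.
exact: (le_bigmax _ (fun ij : _ * _ => `|u ij.1 ij.2|) (ord0, i)).
Qed.

(** Adding 1 makes the constant positive also in dimension 0, so that one can
    divide by it. *)
Lemma enorm_le_norm1 (R : realType) (n : nat) (u : 'rV[R]_n) :
  enorm u <= (Num.sqrt n%:R + 1) * `|u|.
Proof. by rewrite mulrDl mul1r ler_wpDr// enorm_le_norm. Qed.

Lemma nbhs_eball (R : realType) (n : nat) (a : 'rV[R]_n) (r : R) :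
  0 < r -> nbhs a [set y | enorm (y - a) < r].
Proof.
move=> r_gt0; have s_gt0 : 0 < Num.sqrt n%:R + 1 :> R.
  by rewrite ltr_wpDl ?sqrtr_ge0.
apply/nbhs_ballP; exists (r / (Num.sqrt n%:R + 1)); first by rewrite /= divr_gt0.
move=> y; rewrite -ball_normE /= ltr_pdivlMr// mulrC enormB => ya.
exact: le_lt_trans (enorm_le_norm1 _) ya.
Qed.

Lemma eball_sub_nbhs (R : realType) (n : nat) (a : 'rV[R]_n) U :
  nbhs a U -> exists2 r, 0 < r & forall y, enorm (y - a) < r -> U y.
Proof.
move=> /nbhs_ballP[r /= r_gt0 rU]; exists r => // y ya; apply: rU.
rewrite -ball_normE /= distrC; apply: le_lt_trans (norm_le_enorm _) ya.
Qed.

Lemma cvg_enormP (R : realType) (n : nat) (u : nat -> 'rV[R]_n) (a : 'rV[R]_n) :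
  (forall e, 0 < e -> \forall k \near \oo, enorm (u k - a) < e) ->
  u @ \oo --> a.
Proof.
move=> ua U /eball_sub_nbhs[r r_gt0 rU].
by near do apply: rU; exact: ua.
Unshelve. all: by end_near. Qed.

Lemma accumulation_enorm (R : realType) (n : nat) (u : nat -> 'rV[R]_n)
    (a : 'rV[R]_n) (e : R) (N : nat) : accumulation_point u a -> 0 < e ->
  exists2 k, (N <= k)%N & enorm (u k - a) < e.
Proof.
move=> ua e_gt0.
have uN : (u @ \oo) (u @` [set k | (N <= k)%N]).
  by exists N => // k /= Nk; exists k.
by have [_ [[k /= Nk <-] ?]] := ua _ _ uN (nbhs_eball a e_gt0); exists k.
Qed.

Lemma accumulation_value (R : realType) (n : nat) (f : 'rV[R]_n -> R)
    (x : nat -> 'rV[R]_n) (xbar : 'rV[R]_n) (e : R) (m : nat) :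
    accumulation_point x xbar -> {for xbar, continuous f} -> 0 < e ->
  exists2 k, (m <= k)%N & `|f (x k) - f xbar| < e.
Proof.
move=> x_acc f_cont e_gt0.
have : \forall y \near xbar, `|f xbar - f y| < e.
  exact: (cvgr_dist_lt f (f xbar) f_cont).
move=> /eball_sub_nbhs[r r_gt0 rP].
have [k mk xk] := accumulation_enorm m x_acc r_gt0.
by exists k => //; rewrite distrC; exact: rP.
Qed.

(** * The descent lemma *)

Lemma derive_grad (R : realType) (n : nat) (f : 'rV[R]_n -> R)
    (x v : 'rV[R]_n) : differentiable f x -> 'D_v f x = edot (grad f x) v.
Proof.
move=> df; rewrite deriveE// [v in LHS]row_sum_delta linear_sum /edot.
by apply: eq_bigr => i _; rewrite linearZ /= mxE deriveE// mulrC.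
Qed.

(** The difference quotients of f along the line are those of the directional
    derivative, which reduces the multivariate statement to one variable. *)
Lemma is_derive_line (R : realType) (n : nat) (f : 'rV[R]_n -> R)
    (x d : 'rV[R]_n) (s : R) : differentiable f (x + s *: d) ->
  is_derive s 1 (fun r => f (x + r *: d)) (edot (grad f (x + s *: d)) d).
Proof.
move=> df; have quotient_eq :
    (fun h : R => h^-1 *: (((fun r => f (x + r *: d)) \o shift s) (h *: 1) -
                           f (x + s *: d))) =
    (fun h : R => h^-1 *: ((f \o shift (x + s *: d)) (h *: d) - f (x + s *: d))).
  apply/funext => h /=; congr (_ *: (f _ - _)).
  by rewrite [h *: 1]mulr1 scalerDl addrCA.
split; first by rewrite /derivable quotient_eq; exact: diff_derivable.
by rewrite /derive quotient_eq -derive_grad.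
Qed.

(** Along the segment from x to x + d, the difference between f and the
    quadratic bound has a nonpositive derivative, because the Lipschitz bound on
    the gradient controls the growth of the directional derivative. *)
Lemma descent_lemma (R : realType) (n : nat) (f : 'rV[R]_n -> R) (L : R)
    (x d : 'rV[R]_n) : (forall y, differentiable f y) ->
    (forall y z, enorm (grad f y - grad f z) <= L * enorm (y - z)) ->
  f (x + d) <= f x + edot (grad f x) d + L / 2 * enorm d ^+ 2.
Proof.
move=> df f_lip.
pose h (s : R) := f (x + s *: d) + (- edot (grad f x) d) * s +
                  (- (L / 2 * enorm d ^+ 2)) * s ^+ 2.
have dh (s : R) : is_derive s 1 h (edot (grad f (x + s *: d)) d
    + (- edot (grad f x) d) + (- (L / 2 * enorm d ^+ 2)) * (2 * s)).
  have := is_derive_line (df (x + s *: d)) => dfs.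
  rewrite /h; apply: is_derive_eq.
  by rewrite /GRing.scale /=; ring.
have h_decr : h 1 <= h 0.
  apply: (@ler0_derive1_le_cc R h 0 1) => //.
  - move=> s; rewrite in_itv /= => /andP[s_gt0 _].
    rewrite derive1E derive_val.
    have grad_diff : edot (grad f (x + s *: d) - grad f x) d <=
        L * s * enorm d ^+ 2.
      apply: le_trans (cauchy_schwarz _ _) _.
      rewrite expr2 mulrA ler_wpM2r ?enorm_ge0//.
      apply: le_trans (f_lip _ _) _.
      by rewrite addrAC subrr add0r enormZ gtr0_norm// mulrA.
    move: grad_diff; rewrite edotDl -scaleN1r edotZl; lra.
  - apply: derivable_within_continuous => s _; exact: ex_derive.
  - by rewrite in_itv /= lexx ler01.
  - by rewrite in_itv /= lexx ler01.
move: h_decr; rewrite /h scale0r scale1r addr0; lra.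
Qed.

(** The Young inequality eps * a <= eps / 2 * (a ^ 2 + 1) is what makes 2 the
    critical size of the errors: it leaves the factor 1 - eps / 2 in front of
    the decrease and costs only t * eps / 2. The second-order terms of the
    descent lemma carry an additional factor t, hence they are absorbed once t
    is small, and the total cost of an error is at most t * eps. *)
Lemma inexact_step_decrease (R : realType) (n : nat) (f : 'rV[R]_n -> R)
    (L t e c : R) (x g : 'rV[R]_n) :
    (forall y, differentiable f y) ->
    (forall y z, enorm (grad f y - grad f z) <= L * enorm (y - z)) ->
    0 <= t -> 0 <= e -> 0 <= L -> enorm (g - grad f x) <= e ->
    e / 2 + L * t + c <= 1 -> L * t * e <= 1 / 2 ->
  f (x - t *: g) <= f x - c * (t * enorm (grad f x) ^+ 2) + t * e.
Proof.
move=> df f_lip t_ge0 e_ge0 L_ge0 g_err ec Lte.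
have := descent_lemma x ((- t) *: g) df f_lip.
rewrite enormZ edotZr normrN ger0_norm// scaleNr mulNr.
set G := grad f x; set a := enorm G.
have a_ge0 : 0 <= a by exact: enorm_ge0.
have gE : g = G + (g - G) by rewrite addrC subrK.
have g2 : enorm g ^+ 2 <= 2 * a ^+ 2 + 2 * e ^+ 2.
  rewrite {1}gE; apply: le_trans (enormD_sqr_le _ _) _.
  by rewrite lerD2l ler_wpM2l// ler_sqr ?nnegrE ?enorm_ge0.
have Gg : a ^+ 2 - a * e <= edot G g.
  rewrite {1}gE edotDr edot_self lerD2l lerNl -mulN1r -edotZr.
  apply: le_trans (cauchy_schwarz _ _) _.
  by rewrite enormZ normrN1 mul1r ler_wpM2l.
have young : e * a <= e / 2 * (a ^+ 2 + 1).
  by have := mulr_ge0 e_ge0 (sqr_ge0 (a - 1)); lra.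
have tGg : t * (a ^+ 2 - e / 2 * (a ^+ 2 + 1)) <= t * edot G g.
  by rewrite ler_wpM2l//; lra.
have tg2 : L / 2 * (t * enorm g) ^+ 2 <= L * t ^+ 2 * (a ^+ 2 + e ^+ 2).
  have : 0 <= L / 2 * t ^+ 2 by rewrite !mulr_ge0 ?sqr_ge0.
  by move=> /ler_wpM2l /(_ _ _ g2); rewrite exprMn; lra.
have main : t * a ^+ 2 * (e / 2 + L * t + c) <= t * a ^+ 2 * 1.
  by rewrite ler_wpM2l// mulr_ge0 ?sqr_ge0.
have err : t * e * (L * t * e) <= t * e * (1 / 2).
  by rewrite ler_wpM2l// mulr_ge0.
lra.
Qed.

(** * Series with nonnegative terms *)

(** Cauchy's criterion for the series of u, with only an upper bound: the
    sequences at hand are nonnegative for large indices. The condition is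
    blind to finitely many terms, in particular to those for which the error
    tail lies outside the domain of the desingularizing function. *)
Definition small_tails (R : realType) (u : nat -> R) : Prop :=
  forall e, 0 < e -> exists N, forall m n, (N <= m)%N ->
    \sum_(m <= i < n) u i < e.

(** Stated for the tails in the extended reals, so that it also yields their
    finiteness and their comparison with an extended real bound. *)
Lemma nneseries_tail_lt (R : realType) (u : nat -> R) (N : nat) (e : R) :
    (forall k, (N <= k)%N -> 0 <= u k) ->
    (\sum_(N <= k <oo) (u k)%:E < +oo)%E -> 0 < e ->
  \forall m \near \oo, (\sum_(m <= k <oo) (u k)%:E < e%:E)%E.
Proof.
move=> u_ge0 u_fin e_gt0.
pose v k := if (N <= k)%N then (u k)%:E else 0%E.
have vE m : (N <= m)%N -> (\sum_(m <= k <oo) v k = \sum_(m <= k <oo) (u k)%:E)%E.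
  move=> Nm; apply: congr_lim; apply/funext => n /=.
  by apply: eq_big_nat => k /andP[mk _]; rewrite /v (leq_trans Nm mk).
have v_ge0 k : (0 <= v k)%E by rewrite /v; case: ifPn => // Nk; rewrite lee_fin u_ge0.
have v_fin : (\sum_(0 <= k <oo | true) v k < +oo)%E.
  rewrite (nneseries_split 0 N)// add0n vE//.
  rewrite big_nat_cond big1 ?add0e// => k /andP[/andP[_ kN] _].
  by rewrite /v leqNgt kN.
have /fine_cvgP[tail_fin tail_cvg] := nneseries_tail_cvg v_fin (fun k _ => v_ge0 k).
near=> m; rewrite -vE; last by near: m; exact: nbhs_infty_ge.
have m_fin : (\sum_(m <= k <oo) v k)%E \is a fin_num by near: m.
rewrite -(fineK m_fin) lte_fin; near: m.
exact: (cvgr_lt (0 : R)).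
Unshelve. all: by end_near. Qed.

Lemma nneseries_recl_fine (R : realType) (u : nat -> R) (N m : nat) :
    (forall k, (N <= k)%N -> 0 <= u k) ->
    (\sum_(N <= k <oo) (u k)%:E < +oo)%E -> (N <= m)%N ->
  fine (\sum_(m <= k <oo) (u k)%:E)%E =
    u m + fine (\sum_(m.+1 <= k <oo) (u k)%:E)%E.
Proof.
move=> u_ge0 u_fin Nm.
have tail_ge0 j : (N <= j)%N -> (0 <= \sum_(j <= k <oo) (u k)%:E)%E.
  by move=> Nj; apply: nneseries_ge0 => k jk _; rewrite lee_fin u_ge0// (leq_trans Nj).
have split_at j i : (N <= j)%N -> (\sum_(j <= k <oo) (u k)%:E =
    \sum_(j <= k < j + i) (u k)%:E + \sum_(j + i <= k <oo) (u k)%:E)%E.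
  by move=> Nj; rewrite -nneseries_split// => k jk; rewrite lee_fin u_ge0// (leq_trans Nj).
rewrite (split_at m 1)// addn1 big_nat1 fineD//.
move: u_fin; rewrite (split_at N (m.+1 - N)%N)// subnKC ?leqW// => fin.
rewrite ge0_fin_numE ?tail_ge0 ?leqW//; apply: le_lt_trans fin.
rewrite leeDr// sumEFin lee_fin big_nat_cond sumr_ge0// => k.
by rewrite andbT => /andP[/u_ge0].
Qed.

Lemma sum_diverges_from (R : realType) (u : nat -> R) (N m : nat) (M : R) :
    (forall k, (N <= k)%N -> 0 <= u k) ->
    (\sum_(N <= k <oo) (u k)%:E = +oo)%E -> (N <= m)%N ->
  exists n, M < \sum_(m <= i < n) u i.
Proof.
move=> u_ge0 u_inf Nm; apply: contrapT => /forallNP bounded.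
have : (\sum_(N <= k <oo) (u k)%:E <= (\sum_(N <= k < m) u k + M)%:E)%E.
  rewrite (nneseries_split N (m - N)%N) => [|k Nk]; last by rewrite lee_fin u_ge0.
  rewrite subnKC// sumEFin EFinD leeD2l//; apply: lime_le.
    apply: is_cvg_nneseries => k mk _; rewrite lee_fin u_ge0//.
    exact: leq_trans mk.
  apply: nearW => n; rewrite sumEFin lee_fin leNgt; apply/negP.
  exact: bounded.
by rewrite u_inf leye_eq.
Qed.

(** The sum of u between two indices is at most the decrease of v, and a
    nonincreasing sequence bounded below is eventually close to its infimum. *)
Lemma telescope_small_tails (R : realType) (u v : nat -> R) (N : nat) (b : R) :
    (forall k, (N <= k)%N -> 0 <= u k) ->
    (forall k, (N <= k)%N -> u k <= v k - v k.+1) ->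
    (forall k, (N <= k)%N -> b <= v k) ->
  small_tails u.
Proof.
move=> u_ge0 uv v_lb e e_gt0.
have sum_le m n : (N <= m)%N -> (m <= n)%N ->
    \sum_(m <= i < n) u i <= v m - v n.
  move=> Nm mn; rewrite -opprB -telescope_sumr// -sumrN ler_sum_nat// => i.
  by move=> /andP[mi _]; rewrite opprB uv// (leq_trans Nm).
have v_decr m n : (N <= m)%N -> (m <= n)%N -> v n <= v m.
  move=> Nm mn; rewrite -subr_ge0; apply: le_trans (sum_le _ _ Nm mn).
  by rewrite big_nat_cond sumr_ge0// => i /andP[/andP[mi _] _]; rewrite u_ge0// (leq_trans Nm).
(* some v K is within e of the infimum, and v stays in this window afterwards *)
pose V := [set v k | k in [set k | (N <= k)%N]].
have V_inf : has_inf V.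
  by split; [exists (v N), N => /= | exists b => _ [k /= Nk <-]; exact: v_lb].
have [_ [K /= NK <-] vK] := inf_adherent e_gt0 V_inf.
exists K => m n Km; have Nm := leq_trans NK Km.
have [mn|nm] := leqP m n; last by rewrite big_geq// ltnW.
apply: le_lt_trans (sum_le _ _ Nm mn) _.
have infn : inf V <= v n by apply: ge_inf; [exact: V_inf.2 | exists n => //=; exact: leq_trans mn].
by have := v_decr _ _ NK Km; lra.
Qed.

Lemma small_tailsZ (R : realType) (u : nat -> R) (c : R) : 0 <= c ->
  small_tails u -> small_tails (fun k => c * u k).
Proof.
move=> c_ge0 u_small e e_gt0; have c1_gt0 : 0 < c + 1 by rewrite ltr_wpDl.
have [N uN] := u_small _ (divr_gt0 e_gt0 c1_gt0).
exists N => m n Nm; rewrite -mulr_sumr.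
have := uN m n Nm; rewrite ltr_pdivlMr//; nra.
Qed.

Lemma small_tailsD (R : realType) (u v : nat -> R) :
  small_tails u -> small_tails v -> small_tails (fun k => u k + v k).
Proof.
move=> u_small v_small e e_gt0; have e2_gt0 : 0 < e / 2 by rewrite divr_gt0.
have [[N1 uN1] [N2 vN2]] := (u_small _ e2_gt0, v_small _ e2_gt0).
exists (maxn N1 N2) => m n; rewrite geq_max => /andP[N1m N2m].
by rewrite big_split /= [e]splitr ltrD ?uN1 ?vN2.
Qed.

(** A strict bound on the upper limit leaves a margin: the eventual bound r is
    independent of k. *)
Lemma limn_esup_lt (R : realType) (u : nat -> R) (b : R) :
    (limn_esup (fun k => (u k)%:E) < b%:E)%E ->
  exists2 r, r < b & \forall k \near \oo, u k <= r.
Proof.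
move=> /ereal_inf_lt[_ [V [m _ mV] <-]].
have sup_ge k : (m <= k)%N -> ((u k)%:E <= ereal_sup [set (u i)%:E | i in V])%E.
  by move=> mk; apply: ereal_sup_ubound; exists k => //; exact: mV.
case: (ereal_sup _) sup_ge => [r|//|] sup_ge.
- by rewrite lte_fin => rb; exists r => //; exists m => // k /= /sup_ge; rewrite lee_fin.
- by have := sup_ge m (leqnn m); rewrite leeNy_eq.
Qed.

(** * Sequences governed by a decrease inequality *)

(** Once a is at most d at an index where the tails are small, it stays below
    3 * d: a step starting below d ends below 2 * d, up to an error term, and a
    step starting above d increases a by at most s, because there
    a <= a ^ 2 / d. *)
Lemma dissipation_vanishes (R : realType) (a t w : nat -> R) (L : R) (N : nat) :
    0 <= L ->
    (forall k, (N <= k)%N -> [/\ 0 <= a k, 0 <= t k & 0 <= w k]) ->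
    (forall k, (N <= k)%N -> L * t k <= 1) ->
    (forall m M, (N <= m)%N -> exists n, M < \sum_(m <= i < n) t i) ->
    small_tails w -> small_tails (fun k => t k * a k ^+ 2) ->
    (forall k, (N <= k)%N -> a k.+1 <= a k + L * (t k * a k + w k)) ->
  forall e, 0 < e -> \forall k \near \oo, a k < e.
Proof.
move=> L_ge0 nonneg Lt t_div w_small ta2_small a_step e e_gt0.
pose d := e / 3; have d_gt0 : 0 < d by rewrite divr_gt0.
pose s k := L / d * (t k * a k ^+ 2) + L * w k.
have Ld_ge0 : 0 <= L / d by rewrite divr_ge0// ltW.
have Lta2_ge0 k : (N <= k)%N -> 0 <= L / d * (t k * a k ^+ 2).
  by move=> /nonneg[? ? ?]; apply: mulr_ge0 => //; rewrite mulr_ge0 ?sqr_ge0.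
have s_ge0 k : (N <= k)%N -> 0 <= s k.
  by move=> Nk; have [? ? ?] := nonneg k Nk; rewrite addr_ge0 ?Lta2_ge0 ?mulr_ge0.
have s_small : small_tails s.
  by apply: small_tailsD; apply: small_tailsZ.
have [K1 K1s] := s_small _ d_gt0.
have [K2 K2ta2] := ta2_small _ (ltr01 : 0 < 1 :> R).
pose K := maxn N (maxn K1 K2).
have NK : (N <= K)%N by rewrite leq_maxl.
have [m Km am] : exists2 m, (K <= m)%N & a m <= d.
  apply: contrapT => none.
  have a_large k : (K <= k)%N -> d < a k.
    by move=> Kk; rewrite ltNge; apply/negP => akd; case: none; exists k.
  (* otherwise t * d ^ 2 <= t * a ^ 2 on the whole tail, against the divergence *)
  have [n] := t_div K (d ^- 2) NK; apply/negP; rewrite -leNgt.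
  have ta2_lt1 : \sum_(K <= i < n) t i * a i ^+ 2 < 1.
    by apply: K2ta2; rewrite /K !leq_max leqnn !orbT.
  rewrite -[leRHS]mul1r ler_pdivlMr ?exprn_gt0// mulr_suml ltW//.
  apply: le_lt_trans ta2_lt1; apply: ler_sum_nat => i /andP[Ki _].
  have [a_ge0 t_ge0 _] := nonneg i (leq_trans NK Ki).
  by rewrite ler_wpM2l// ler_sqr ?nnegrE ?(ltW d_gt0)// ltW// a_large.
(* each time a is below d, the budget of the sum can be restarted from 2 * d *)
have bound j : a (m + j)%N <= 2 * d + \sum_(m <= i < m + j) s i.
  elim: j => [|j IHj]; first by rewrite addn0 big_geq// addr0; lra.
  set k := (m + j)%N; rewrite addnS big_nat_recr ?leq_addr//= -/k.
  have Nk : (N <= k)%N by rewrite (leq_trans NK)// (leq_trans Km)// leq_addr.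
  have [a_ge0 t_ge0 w_ge0] := nonneg k Nk.
  have [ad|da] := leP (a k) d.
    have sum_ge0 : 0 <= \sum_(m <= i < k) s i.
      rewrite big_nat_cond sumr_ge0// => i /andP[/andP[mi _] _].
      by rewrite s_ge0// (leq_trans NK)// (leq_trans Km).
    have Ltd : L * t k * a k <= 1 * d by rewrite ler_pM ?mulr_ge0 ?Lt.
    have Lw : L * w k <= s k by rewrite lerDr Lta2_ge0.
    by have := a_step k Nk; lra.
  have La : L * (t k * a k + w k) <= s k.
    rewrite mulrDr lerD2r -mulrA ler_wpM2l// [leRHS]mulrC ler_pdivlMr//.
    by rewrite expr2 -mulrA ler_wpM2l// ler_wpM2l// ltW.
  by have := a_step k Nk; move: IHj; rewrite -/k; lra.
near=> k.
have mk : (m <= k)%N by near: k; exact: nbhs_infty_ge.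
have := bound (k - m)%N; rewrite subnKC//.
have : \sum_(m <= i < k) s i < d.
  by apply: K1s; apply: leq_trans Km; rewrite /K !leq_max leqnn !orbT.
by rewrite /d; lra.
Unshelve. all: by end_near. Qed.

(** The sum F + tau is monotone and tau tends to 0, hence the cluster value l of
    F is the limit of F + tau, and F + tau approaches it from above. *)
Lemma decreasing_to_cluster_value (R : realType) (F tau : nat -> R) (l : R)
    (N : nat) :
    (forall k, (N <= k)%N -> 0 <= tau k) ->
    (forall e, 0 < e -> \forall k \near \oo, tau k < e) ->
    (forall k, (N <= k)%N -> F k.+1 + tau k.+1 <= F k + tau k) ->
    (forall e m, 0 < e -> exists2 k, (m <= k)%N & `|F k - l| < e) ->
  (forall k, (N <= k)%N -> l <= F k + tau k) /\
  (forall e, 0 < e -> \forall k \near \oo, F k + tau k < l + e).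
Proof.
move=> tau_ge0 tau_small decr cluster_l.
have mono m k : (N <= m)%N -> (m <= k)%N -> F k + tau k <= F m + tau m.
  move=> Nm /subnKC <-; elim: (k - m)%N => [|j IHj]; first by rewrite addn0.
  by rewrite addnS; apply: le_trans IHj; rewrite decr// (leq_trans Nm)// leq_addr.
split=> [k Nk|e e_gt0].
  apply/ler_addgt0Pr => e e_gt0.
  have [j kj] := cluster_l e k e_gt0; rewrite ltr_norml => /andP[Fj _].
  have := mono _ _ Nk kj; have := tau_ge0 j (leq_trans Nk kj); lra.
have e2_gt0 : 0 < e / 2 by rewrite divr_gt0.
have [K _ tauK] := tau_small _ e2_gt0.
have [j] := cluster_l (e / 2) (maxn N K) e2_gt0.
rewrite geq_max ltr_norml => /andP[Nj Kj] /andP[_ Fj].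
near=> k.
have jk : (j <= k)%N by near: k; exact: nbhs_infty_ge.
by have := mono _ _ Nj jk; have := tauK j Kj; lra.
Unshelve. all: by end_near. Qed.

(** From an index m where x m is within d of xbar and both v m and the tails of
    s are below d, the step bounds add up to less than 2 * d. So the sequence
    stays within 3 * d <= r of xbar, which is what the step bounds need to be
    applicable at the next index. *)
Lemma trapped_sequence_cvg (R : realType) (n : nat) (x : nat -> 'rV[R]_n)
    (xbar : 'rV[R]_n) (s v : nat -> R) (r : R) (N : nat) :
    0 < r ->
    (forall k, (N <= k)%N -> 0 <= v k) ->
    (forall e, 0 < e -> \forall k \near \oo, v k < e) ->
    small_tails s ->
    (forall k, (N <= k)%N -> enorm (x k - xbar) < r ->
      enorm (x k.+1 - x k) <= v k - v k.+1 + s k) ->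
    accumulation_point x xbar ->
  x @ \oo --> xbar.
Proof.
move=> r_gt0 v_ge0 v_small s_small step x_acc.
apply: cvg_enormP => e e_gt0.
pose d := Num.min e r / 3.
have d_gt0 : 0 < d by rewrite divr_gt0// lt_min e_gt0.
have d3 : 3 * d = Num.min e r by rewrite /d; lra.
have [d3e d3r] : 3 * d <= e /\ 3 * d <= r.
  by rewrite d3 !ge_min !lexx orbT.
have [K1 _ vK] := v_small _ d_gt0.
have [K2 sK] := s_small _ d_gt0.
have [m] := accumulation_enorm (maxn N (maxn K1 K2)) x_acc d_gt0.
rewrite !geq_max => /and3P[Nm K1m K2m] xm.
have stay j : enorm (x (m + j)%N - xbar) <=
    enorm (x m - xbar) + (v m - v (m + j)%N) + \sum_(m <= i < m + j) s i.
  elim: j => [|j IHj]; first by rewrite addn0 big_geq// subrr !addr0.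
  set k := (m + j)%N in IHj *; rewrite addnS big_nat_recr ?leq_addr//= -/k.
  have mk : (m <= k)%N by rewrite leq_addr.
  have Nk := leq_trans Nm mk.
  have sum_lt : \sum_(m <= i < k) s i < d by exact: sK.
  have xk : enorm (x k - xbar) < r.
    by have := v_ge0 k Nk; have := vK m K1m; lra.
  have := step k Nk xk; have := enorm_triangle (x k.+1) (x k) xbar; lra.
near=> k.
have mk : (m <= k)%N by near: k; exact: nbhs_infty_ge.
have := stay (k - m)%N; rewrite subnKC//.
have := v_ge0 k (leq_trans Nm mk); have := vK m K1m; have := sK m k K2m; lra.
Unshelve. all: by end_near. Qed.

(** * Desingularizing functions *)

(** A concave function lies below its tangents. If the derivative at a were
    larger than the slope of the chord from b to a, so would be the slope of a
    short chord ending at a, against concavity. *)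
Lemma desingularizing_tangent (R : realType) (eta : \bar R) (phi : R -> R)
    (a b : R) : desingularizing eta phi -> 0 <= b -> b <= a -> 0 < a ->
    (a%:E < eta)%E ->
  derive1 phi a * (a - b) <= phi a - phi b.
Proof.
move=> [_ concave _ _ smooth] b_ge0 ba a_gt0 a_eta.
have [dphi _ _] := smooth a a_gt0 a_eta.
move: ba; rewrite le_eqVlt => /predU1P[->|ba]; first by rewrite !subrr mulr0.
have ab_gt0 : 0 < a - b by rewrite subr_gt0.
rewrite -ler_pdivlMr// leNgt; apply/negP => slope_lt.
have : \forall h \near (0 : R)^', (phi a - phi b) / (a - b) <
    h^-1 *: ((phi \o shift a) (h *: 1) - phi a).
  by apply: (cvgr_gt (derive1 phi a)) => //; rewrite derive1E; exact: dphi.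
move=> /nbhs_ballP[r /= r_gt0 rP].
(* the step h = s * (b - a) below has a length less than both r and a - b *)
pose s := Num.min (1 / 2) (r / 2 / (a - b)).
have s_gt0 : 0 < s by rewrite lt_min !divr_gt0.
have s_le1 : s <= 1 by rewrite ge_min; apply/orP; left; lra.
have sr : s * (a - b) < r.
  have : s <= r / 2 / (a - b) by rewrite ge_min lexx orbT.
  by rewrite ler_pdivlMr//; lra.
have h_neq0 : s * (b - a) != 0 by rewrite mulf_neq0 ?(gt_eqF s_gt0)// subr_eq0 lt_eqF.
have := rP (s * (b - a)) _ h_neq0.
rewrite -ball_normE /= sub0r -mulrN opprB ger0_norm ?mulr_ge0 ?ltW//.
move=> /(_ sr) /=; rewrite [_%:A]mulr1 => slope_gt.
have D_b : b \in [set s : R | 0 <= s /\ (s%:E < eta)%E].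
  by rewrite inE /=; split=> //; apply: lt_trans a_eta; rewrite lte_fin.
have D_a : a \in [set s : R | 0 <= s /\ (s%:E < eta)%E].
  by rewrite inE /= ltW.
have : - phi (s * b + (1 - s) * a) <= s * (- phi b) + (1 - s) * (- phi a).
  exact: (concave (Itv01 (ltW s_gt0) s_le1) b a D_b D_a).
have -> : s * b + (1 - s) * a = s * (b - a) + a by ring.
have ba_neg : s * (b - a) < 0 by rewrite nmulr_llt0 ?subr_lt0.
move: slope_gt; rewrite -(ltr_nM2r ba_neg) /GRing.scale /=.
rewrite [X in X < _]mulrC mulVKf ?lt_eqF//.
have -> : (phi a - phi b) / (a - b) * (s * (b - a)) = s * (phi b - phi a).
  by field; rewrite gt_eqF.
lra.
Qed.

Lemma desingularizing_small (R : realType) (eta : \bar R) (phi : R -> R)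
    (e : R) : (0 < eta)%E -> desingularizing eta phi -> 0 < e ->
  exists2 d, 0 < d & forall s, 0 <= s -> s < d -> (s%:E < eta)%E -> phi s < e.
Proof.
move=> eta_gt0 [_ _ phi_cont phi0 _] e_gt0.
have /subspace_continuousP/(_ 0) := phi_cont.
move=> /(_ (conj (lexx 0) eta_gt0)); rewrite /from_subspace /= phi0 => phi_cvg.
have := phi_cvg [set y | y < e] (lt_nbhsl e_gt0).
move=> /nbhs_ballP[d /= d_gt0 d_phi].
exists d => // s s_ge0 sd s_eta; apply: d_phi => //.
by rewrite -ball_normE /= sub0r normrN ger0_norm.
Qed.

Lemma real_below (R : realType) (eta : \bar R) : (0 < eta)%E ->
  exists2 d : R, 0 < d & (d%:E <= eta)%E.
Proof.
case: eta => [d|_|//]; first by rewrite lte_fin => d_gt0; exists d.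
by exists 1 => //; exact: leey.
Qed.

(** * Convergence of the iterates under the KL inequality *)

(** Dividing a quadratic bound by its unknown: if t * a were larger, D would be
    less than c * t * (a - p), so that D * (a + p) < c * t * (a ^ 2 - p ^ 2). *)
Lemma quadratic_cancel (R : realType) (c t a p D : R) :
    0 < c -> 0 <= t -> 0 <= a -> 0 <= p -> 0 <= D ->
    c * (t * a ^+ 2) <= D * (a + p) ->
  t * a <= D / c + t * p.
Proof.
move=> c_gt0 t_ge0 a_ge0 p_ge0 D_ge0 quad.
rewrite leNgt; apply/negP => large.
have Dc : D < c * (t * a - t * p) by rewrite mulrC -ltr_pdivrMr//; lra.
have [ap0|ap_neq0] := eqVneq (a + p) 0.
  have a0 : a = 0 by lra.
  by have := mulr_ge0 t_ge0 p_ge0; move: large; have := divr_ge0 D_ge0 (ltW c_gt0); rewrite a0 mulr0; lra.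
have ap_gt0 : 0 < a + p by rewrite lt_neqAle eq_sym ap_neq0 addr_ge0.
have : D * (a + p) < c * (t * a - t * p) * (a + p) by rewrite ltr_pM2r.
have : 0 <= c * (t * p ^+ 2) by rewrite !mulr_ge0 ?sqr_ge0// ltW.
by lra.
Qed.

(** The KL inequality turns the decrease of the merit f (x k) + tau k into a
    bound on the step lengths by the differences of phi along the merit. The
    tail tau enters through quasi-additivity, as the KL inequality only speaks
    of f (x k) - f xbar. *)
Lemma KL_descent_cvg (R : realType) (n : nat) (f : 'rV[R]_n -> R)
    (xbar : 'rV[R]_n) (eta : \bar R) (phi : R -> R) (x : nat -> 'rV[R]_n)
    (t w tau : nat -> R) (c : R) (N : nat) :
    KL_with f xbar eta phi -> quasi_additive eta phi -> 0 < c ->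
    accumulation_point x xbar -> {for xbar, continuous f} ->
    (forall k, (N <= k)%N -> 0 <= t k) ->
    (forall k, (N <= k)%N -> 0 < tau k) ->
    (forall e, 0 < e -> \forall k \near \oo, tau k < e) ->
    (forall k, (N <= k)%N ->
      f (x k.+1) + tau k.+1 + c * (t k * enorm (grad f (x k)) ^+ 2) <=
      f (x k) + tau k) ->
    (forall k, (N <= k)%N ->
      enorm (x k.+1 - x k) <= t k * enorm (grad f (x k)) + w k) ->
    small_tails w -> small_tails (fun k => t k * (derive1 phi (tau k))^-1) ->
    (forall k, (N <= k)%N -> f xbar < f (x k)) ->
  x @ \oo --> xbar.
Proof.
move=> [eta_gt0 desing [U U_xbar KL]] [C C_gt0 quasi_add] c_gt0 x_acc f_cont
  t_ge0 tau_gt0 tau_small decrease step w_small q_small f_gt.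
pose a k := enorm (grad f (x k)).
pose u k := f (x k) - f xbar.
pose Delta k := u k + tau k.
have [phi_ge0 _ _ _ phi_smooth] := desing.
have u_gt0 k : (N <= k)%N -> 0 < u k by move=> Nk; rewrite subr_gt0 f_gt.
have Delta_gt0 k : (N <= k)%N -> 0 < Delta k.
  by move=> Nk; rewrite addr_gt0 ?u_gt0 ?tau_gt0.
have cta2_ge0 k : (N <= k)%N -> 0 <= c * (t k * enorm (grad f (x k)) ^+ 2).
  move=> Nk; apply: mulr_ge0; first exact: ltW.
  by apply: mulr_ge0; [exact: t_ge0 | exact: sqr_ge0].
have Delta_small e : 0 < e -> \forall k \near \oo, Delta k < e.
  move=> e_gt0.
  have [_ /(_ e e_gt0) small] : (forall k, (N <= k)%N -> f xbar <= f (x k) + tau k) /\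
      (forall e, 0 < e -> \forall k \near \oo, f (x k) + tau k < f xbar + e).
    apply: decreasing_to_cluster_value tau_small _ _.
    - by move=> k /tau_gt0/ltW.
    - move=> k Nk; apply: le_trans (decrease k Nk); rewrite lerDl.
      exact: cta2_ge0.
    - by move=> d m; exact: accumulation_value.
  near=> k; have : f (x k) + tau k < f xbar + e by near: k.
  by rewrite /Delta /u; lra.
have [r r_gt0 rU] := eball_sub_nbhs U_xbar.
have [d d_gt0 d_eta] := real_below eta_gt0.
have [N1 _ Delta_eta] : \forall k \near \oo, ((Delta k)%:E < eta)%E.
  near=> k; apply: lt_le_trans d_eta; rewrite lte_fin.
  by near: k; exact: Delta_small.
pose K := maxn N N1; have NK : (N <= K)%N by rewrite leq_maxl.
have N1K : (N1 <= K)%N by rewrite leq_maxr.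
have Cc_gt0 : 0 < C * c by rewrite mulr_gt0.
have D_ge0 k : (K <= k)%N -> 0 <= Delta k - Delta k.+1.
  move=> Kk; have Nk := leq_trans NK Kk.
  by have := cta2_ge0 k Nk; have := decrease k Nk; rewrite /Delta /u; lra.
apply: (@trapped_sequence_cvg R n x xbar
  (fun k => t k * (derive1 phi (tau k))^-1 + w k)
  (fun k => phi (Delta k) / (C * c)) r K) => //.
- move=> k Kk; rewrite divr_ge0 ?(ltW Cc_gt0)// phi_ge0//=; split.
    by rewrite ltW// Delta_gt0// (leq_trans NK).
  by apply: Delta_eta; exact: leq_trans N1K Kk.
- move=> e e_gt0.
  have [s s_gt0 s_phi] := desingularizing_small eta_gt0 desing (mulr_gt0 e_gt0 Cc_gt0).
  near=> k; have Nk : (N <= k)%N by near: k; exact: nbhs_infty_ge.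
  rewrite ltr_pdivrMr//; apply: s_phi; first by rewrite ltW ?Delta_gt0.
    by near: k; exact: Delta_small.
  by apply: Delta_eta => /=; near: k; exact: nbhs_infty_ge.
- exact: small_tailsD.
- move=> k Kk xk; have Nk := leq_trans NK Kk.
  apply: le_trans (step k Nk) _; rewrite addrA lerD2r -mulrBl.
  have Dk_eta := Delta_eta k (leq_trans N1K Kk).
  have u_eta : ((u k)%:E < eta)%E.
    by apply: lt_trans Dk_eta; rewrite lte_fin ltrDl tau_gt0.
  have tau_eta : ((tau k)%:E < eta)%E.
    by apply: lt_trans Dk_eta; rewrite lte_fin ltrDr u_gt0.
  have [_ _ dphi_u] := phi_smooth _ (u_gt0 k Nk) u_eta.
  have [_ _ dphi_tau] := phi_smooth _ (tau_gt0 k Nk) tau_eta.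
  have [_ _ dphi_Delta] := phi_smooth _ (Delta_gt0 k Nk) Dk_eta.
  have tangent : derive1 phi (Delta k) * (Delta k - Delta k.+1) <=
      phi (Delta k) - phi (Delta k.+1).
    apply: desingularizing_tangent desing _ _ (Delta_gt0 k Nk) Dk_eta.
      by rewrite ltW// Delta_gt0// leqW.
    by rewrite -subr_ge0 D_ge0.
  have inv_u : (derive1 phi (u k))^-1 <= a k.
    by rewrite -[_^-1]mul1r ler_pdivrMr// mulrC; apply: KL => //; [exact: rU | exact: u_gt0].
  have inv_Delta : C / derive1 phi (Delta k) <= a k + (derive1 phi (tau k))^-1.
    apply: le_trans (quasi_add _ _ (u_gt0 k Nk) u_eta (tau_gt0 k Nk) tau_eta Dk_eta) _.
    by rewrite lerD2r.
  have D_phi_ge0 : 0 <= phi (Delta k) - phi (Delta k.+1).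
    by apply: le_trans tangent; rewrite mulr_ge0 ?D_ge0// ltW.
  apply: quadratic_cancel => //; [exact: t_ge0|exact: enorm_ge0|by rewrite invr_ge0 ltW|].
  apply: le_trans (ler_wpM2l D_phi_ge0 inv_Delta).
  have tangent_ta2 : derive1 phi (Delta k) * (c * (t k * a k ^+ 2)) <=
      phi (Delta k) - phi (Delta k.+1).
    apply: le_trans tangent; rewrite ler_pM2l//.
    by have := decrease k Nk; rewrite /Delta /u /a; lra.
  rewrite [leRHS]mulrA ler_pdivlMr// -/(a k).
  by have := ler_wpM2l (ltW C_gt0) tangent_ta2; lra.
Unshelve. all: by end_near. Qed.

(** * Convergence of the inexact gradient method *)

Theorem theorem3p3 (R : realType) (n : nat) (f : 'rV[R]_n -> R) (L : R)
    (x g : nat -> 'rV[R]_n) (t eps : nat -> R)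
    (f_C1 : C1 f)
    (L_gt0 : 0 < L)
    (f_lip : forall y z, enorm (grad f y - grad f z) <= L * enorm (y - z))
    (x_rec : forall k, (1 <= k)%N -> x k.+1 = x k - t k *: g k)
    (g_err : forall k, (1 <= k)%N -> enorm (g k - grad f (x k)) <= eps k)
    (t_gt0 : forall k, (1 <= k)%N -> 0 < t k)
    (eps_gt0 : forall k, (1 <= k)%N -> 0 < eps k)
    (t_sum : (\sum_(1 <= k <oo) (t k)%:E = +oo)%E)
    (t_cvg : t @ \oo --> (0 : R))
    (teps_sum : (\sum_(1 <= k <oo) (t k * eps k)%:E < +oo)%E)
    (eps_limsup : (limn_esup (fun k => (eps k)%:E) < 2%:E)%E)
    (f_inf : (-oo < ereal_inf [set (f (x k))%:E | k in [set k | (1 <= k)%N]])%E) :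
  [/\ (grad f (x k) @[k --> \oo] --> (0 : 'rV[R]_n)) /\
      (forall xbar, accumulation_point x xbar -> stationary f xbar),

      forall xbar, accumulation_point x xbar ->
        f (x k) @[k --> \oo] --> f xbar,

      forall (xbar : 'rV[R]_n) (eta : \bar R) (phi : R -> R),
        accumulation_point x xbar ->
        KL_with f xbar eta phi ->
        quasi_additive eta phi ->
        summable_errors eta phi t eps ->
        (\forall k \near \oo, f xbar < f (x k)) ->
        x @ \oo --> xbar
    & forall (xbar : 'rV[R]_n) (eta : \bar R) (phi : R -> R),
        accumulation_point x xbar ->
        KL_with f xbar eta phi ->
        quasi_additive eta phi ->
        summable_errors eta phi t eps ->
        (forall y, f xbar <= f y) ->
        (exists2 k, (1 <= k)%N & f (x k) = f xbar) \/ x @ \oo --> xbar].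
Proof.
have [df grad_cont] := f_C1.
have f_cont y : {for y, continuous f} by exact: differentiable_continuous.
pose a k := enorm (grad f (x k)).
pose w k := t k * eps k.
pose tau k := fine (error_tail t eps k).
have w_gt0 k : (1 <= k)%N -> 0 < w k.
  by move=> k_ge1; rewrite mulr_gt0 ?t_gt0 ?eps_gt0.
have w_ge0 k : (1 <= k)%N -> 0 <= w k by move/w_gt0/ltW.
have tail_ge0 k : (1 <= k)%N -> (0 <= error_tail t eps k)%E.
  move=> k_ge1; apply: nneseries_ge0 => i ki _.
  by rewrite lee_fin w_ge0// (leq_trans k_ge1).
have tau_rec k : (1 <= k)%N -> tau k = w k + tau k.+1.
  exact: (nneseries_recl_fine w_ge0 teps_sum).
have tau_ge0 k : (1 <= k)%N -> 0 <= tau k.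
  by move=> k_ge1; apply: fine_ge0; exact: tail_ge0.
have tau_gt0 k : (1 <= k)%N -> 0 < tau k.
  by move=> k_ge1; rewrite tau_rec// ltr_wpDr ?w_gt0 ?tau_ge0.
have tail_small e : 0 < e -> \forall k \near \oo, (error_tail t eps k < e%:E)%E.
  exact: (nneseries_tail_lt w_ge0 teps_sum).
have tau_small e : 0 < e -> \forall k \near \oo, tau k < e.
  move=> e_gt0; near=> k.
  have k_ge1 : (1 <= k)%N by near: k; exact: nbhs_infty_ge.
  have tail_lt : (error_tail t eps k < e%:E)%E by near: k; exact: tail_small.
  by rewrite -lte_fin fineK// ge0_fin_numE ?tail_ge0// (lt_trans tail_lt)// ltry.
have [rho rho_lt2 eps_le] := limn_esup_lt eps_limsup.
(* half of the margin 1 - rho / 2 pays for the second-order term L * t k *)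
pose c := (1 - rho / 2) / 2.
have c_gt0 : 0 < c by rewrite /c; lra.
have [N _ evN] : \forall k \near \oo,
    [/\ (1 <= k)%N, eps k <= rho, L * t k <= c & L * t k <= 1 / 4].
  have m_gt0 : 0 < Num.min c (1 / 4) / L by rewrite divr_gt0// lt_min c_gt0; lra.
  near=> k.
  have : t k < Num.min c (1 / 4) / L by near: k; exact: (cvgr_lt (0 : R)).
  rewrite ltr_pdivlMr// lt_min mulrC => /andP[/ltW Ltc /ltW Lt4]; split=> //.
    by near: k; exact: nbhs_infty_ge.
  by near: k.
have N_ge1 k : (N <= k)%N -> (1 <= k)%N by move=> /evN[].
have t_ge0 k : (N <= k)%N -> 0 <= t k by move=> /N_ge1/t_gt0/ltW.
have decrease k : (N <= k)%N ->
    f (x k.+1) + tau k.+1 + c * (t k * a k ^+ 2) <= f (x k) + tau k.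
  move=> Nk; have [k_ge1 epsk Ltc Lt4] := evN k Nk.
  have eps_ge0 : 0 <= eps k by rewrite ltW ?eps_gt0.
  have : f (x k - t k *: g k) <= f (x k) - c * (t k * a k ^+ 2) + t k * eps k.
    apply: inexact_step_decrease (f_lip) _ _ _ _ _ _ => //.
    - exact: t_ge0.
    - exact: ltW.
    - exact: g_err.
    - by move: Ltc; rewrite /c; lra.
    - by have := ler_wpM2r eps_ge0 Lt4; lra.
  by rewrite -x_rec// (tau_rec k)// /w; lra.
have step k : (N <= k)%N -> enorm (x k.+1 - x k) <= t k * a k + w k.
  move=> Nk; have k_ge1 := N_ge1 k Nk.
  rewrite x_rec// addrAC subrr add0r enormN enormZ ger0_norm ?t_ge0// -mulrDr.
  rewrite ler_wpM2l ?t_ge0//.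
  have := enormD (grad f (x k)) (g k - grad f (x k)); rewrite addrC subrK.
  by have := g_err k k_ge1; rewrite -/(a k); lra.
have [b f_ge] : exists b, forall k, (1 <= k)%N -> b <= f (x k).
  have inf_le k : (1 <= k)%N -> (ereal_inf [set (f (x k))%:E | k in
      [set k | (1 <= k)%N]] <= (f (x k))%:E)%E.
    by move=> k_ge1; apply: ereal_inf_lbound; exists k.
  case: (ereal_inf _) f_inf inf_le => [b _|_|//] inf_le.
  - by exists b => k /inf_le; rewrite lee_fin.
  - by have := inf_le 1%N isT; rewrite leye_eq.
have w_small : small_tails w.
  apply: (telescope_small_tails (v := tau) (b := 0) w_ge0) => // k k_ge1.
  by rewrite [tau k]tau_rec// addrK.
have ta2_small : small_tails (fun k => t k * a k ^+ 2).
  apply: (@telescope_small_tails _ _ (fun k => (f (x k) + tau k) / c) N (b / c)).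
  - by move=> k Nk; apply: mulr_ge0; [exact: t_ge0 | exact: sqr_ge0].
  - move=> k Nk; rewrite -mulrBl ler_pdivlMr// mulrC.
    by have := decrease k Nk; lra.
  - move=> k /N_ge1 k_ge1; rewrite ler_pM2r ?invr_gt0//.
    by have := f_ge k k_ge1; have := tau_ge0 k k_ge1; lra.
have a_small e : 0 < e -> \forall k \near \oo, a k < e.
  apply: (@dissipation_vanishes R a t w L N) => //.
  - exact: ltW.
  - by move=> k Nk; rewrite /a enorm_ge0 t_ge0 ?w_ge0 ?N_ge1.
  - by move=> k /evN[_ _ _]; lra.
  - move=> m M /N_ge1 m_ge1; apply: (sum_diverges_from (N := 1)) => //.
    by move=> k k_ge1; rewrite ltW ?t_gt0.
  - move=> k Nk; apply: le_trans (_ : _ <= a k + L * enorm (x k.+1 - x k)) _.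
      have := enormD (grad f (x k.+1) - grad f (x k)) (grad f (x k)).
      by rewrite subrK -!/(a _); have := f_lip (x k.+1) (x k); lra.
    by rewrite lerD2l ler_wpM2l ?step// ltW.
have KL_cvg xbar eta phi : accumulation_point x xbar ->
    KL_with f xbar eta phi -> quasi_additive eta phi ->
    summable_errors eta phi t eps ->
    (\forall k \near \oo, f xbar < f (x k)) -> x @ \oo --> xbar.
  move=> x_acc KL quasi_add summable [K _ f_gt].
  have [eta_gt0 [_ _ _ _ phi_smooth] _] := KL.
  pose M := maxn N K.
  pose q k := t k * (derive1 phi (tau k))^-1.
  (* the terms outside the domain of phi' are replaced by 0 to get a genuine
     series of nonnegative terms *)
  pose q0 k := if (error_tail t eps k < eta)%E then q k else 0.
  have q0_ge0 k : (1 <= k)%N -> 0 <= q0 k.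
    move=> k_ge1; rewrite /q0; case: ifPn => // tail_eta.
    have tau_eta : ((tau k)%:E < eta)%E.
      rewrite fineK// ge0_fin_numE ?tail_ge0//.
      by apply: lt_le_trans tail_eta (leey _).
    have [_ _ dphi_gt0] := phi_smooth _ (tau_gt0 k k_ge1) tau_eta.
    by rewrite /q divr_ge0// ltW ?t_gt0.
  have q0_fin : (\sum_(1 <= k <oo) (q0 k)%:E < +oo)%E.
    move: summable; rewrite /summable_errors eseries_mkcond.
    congr (_ < _)%E; apply: eq_eseriesr => k _.
    by rewrite /q0; case: ifP.
  have q0_small : small_tails q0.
    pose sigma k := fine (\sum_(k <= i <oo) (q0 i)%:E)%E.
    apply: (telescope_small_tails (v := sigma) (b := 0) q0_ge0) => k k_ge1.
      by rewrite /sigma (nneseries_recl_fine q0_ge0)// addrK.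
    apply: fine_ge0; apply: nneseries_ge0 => i ki _.
    by rewrite lee_fin q0_ge0// (leq_trans k_ge1).
  have q_small : small_tails q.
    have [d d_gt0 d_eta] := real_below eta_gt0.
    have [K1 _ K1_eta] := tail_small d d_gt0.
    move=> e e_gt0; have [K2 q0_lt] := q0_small e e_gt0.
    exists (maxn K1 K2) => m j; rewrite geq_max => /andP[K1m K2m].
    rewrite (eq_big_nat _ _ (F2 := q0)) ?q0_lt// => i /andP[mi _].
    by rewrite /q0 (lt_le_trans (K1_eta i (leq_trans K1m mi)) d_eta).
  apply: (@KL_descent_cvg R n f xbar eta phi x t w tau c M) => //.
  - by move=> k; rewrite geq_max => /andP[/t_ge0].
  - by move=> k; rewrite geq_max => /andP[/N_ge1/tau_gt0].
  - by move=> k; rewrite geq_max => /andP[/decrease].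
  - by move=> k; rewrite geq_max => /andP[/step].
  - by move=> k; rewrite geq_max => /andP[_ /f_gt].
split.
- split=> [|xbar x_acc].
    by apply: cvg_enormP => e e_gt0; near do rewrite subr0; exact: a_small.
  rewrite /stationary; apply/eqP; rewrite -normr_le0.
  apply: (le_trans (norm_le_enorm _)); apply/ler_addgt0Pr => e e_gt0.
  rewrite add0r [e]splitr; have e2_gt0 : 0 < e / 2 by rewrite divr_gt0.
  have [K _ aK] := a_small _ e2_gt0.
  have [k Kk xk] := accumulation_enorm K x_acc (divr_gt0 e2_gt0 L_gt0).
  have := enormD (grad f xbar - grad f (x k)) (grad f (x k)); rewrite subrK.
  have := f_lip xbar (x k); rewrite enormB (enormB xbar).
  move: xk; rewrite ltr_pdivlMr// [_ * L]mulrC.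
  by have := aK k Kk; rewrite -/(a k); lra.
- move=> xbar x_acc; apply/cvgrPdist_lt => e e_gt0.
  have [F_ge F_lt] : (forall k, (N <= k)%N -> f xbar <= f (x k) + tau k) /\
      (forall e, 0 < e -> \forall k \near \oo, f (x k) + tau k < f xbar + e).
    apply: decreasing_to_cluster_value tau_small _ _.
    - by move=> k /N_ge1/tau_ge0.
    - move=> k Nk; apply: le_trans (decrease k Nk); rewrite lerDl.
      apply: mulr_ge0; first exact: ltW.
      by apply: mulr_ge0; [exact: t_ge0 | exact: sqr_ge0].
    - by move=> d m; exact: accumulation_value.
  near=> k; rewrite distrC ltr_norml; apply/andP; split.
    have Nk : (N <= k)%N by near: k; exact: nbhs_infty_ge.
    have := F_ge k Nk; have : tau k < e by near: k; exact: tau_small.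
    by lra.
  have : f (x k) + tau k < f xbar + e by near: k; exact: F_lt.
  have : 0 <= tau k by apply: tau_ge0; near: k; exact: nbhs_infty_ge.
  by lra.
- exact: KL_cvg.
- move=> xbar eta phi x_acc KL quasi_add summable f_min.
  have [hit|no_hit] := pselect (exists2 k, (1 <= k)%N & f (x k) = f xbar).
    by left.
  right; apply: KL_cvg x_acc KL quasi_add summable _.
  near=> k; rewrite lt_neqAle f_min andbT; apply/eqP => fk; case: no_hit.
  by exists k; [near: k; exact: nbhs_infty_ge | ].
Unshelve. all: by end_near. Qed.
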